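(* Let $a\ge 2$, $c>0$, $d$ be integers with $d<ca$ and $\gcd(d,a)=\gcd(d,c)=1$, let $n\ge 1$, and let $\mathbf s_j=ca^{n+j}-d$ for $j\in\mathbb N$ and $S_n=\langle\{\mathbf s_j:j\in\mathbb N\}\rangle$. Assume $d>0$. Let $m=e(S_n)$, assume $m\ge2$, let $\lambda=\gcd(S_n)$, and let $(\alpha_1,\ldots,\alpha_{m-1})$ be the unique residual $(m-1)$-tuple such that $\mathbf s_0/\lambda=1+\sum_{j=1}^{m-1}\alpha_j\mathbf R_j$ (such a tuple exists and is unique). Then $$\max\mathrm{Ap}(S_n,\mathbf s_0)=\sum_{j=1}^{m-1}\alpha_j\mathbf s_j.$$ Moreover, for the numerical semigroup $(1/\lambda)S_n$ we have $$\mathrm F((1/\lambda)S_n)=\sum_{j=1}^{m-1}\alpha_j(\mathbf s_j/\lambda)-\mathbf s_0/\lambda.$$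
   Context: $\mathbb N=\{0,1,2,\ldots\}$. For $A\subseteq\mathbb N$, $\langle A\rangle$ is the submonoid of $(\mathbb N,+)$ generated by $A$. For a nontrivial submonoid $M$ of $\mathbb N$, the minimal generating set of $M$ is the unique generating set contained in every generating set of $M$ (its elements are the nonzero elements of $M$ that are not sums of two nonzero elements of $M$; it is finite), and $e(M)$ is its cardinality. $\gcd(M)$ denotes the greatest common divisor of all elements of $M$, and with $\lambda=\gcd(M)$, $(1/\lambda)M=\{x/\lambda:x\in M\}$, which is a numerical semigroup (a submonoid of $\mathbb N$ with finite complement). For a numerical semigroup $S$, the Frobenius number $\mathrm F(S)$ is the largest element of $\mathbb N\setminus S$. For $x\in M\setminus\{0\}$, the Apéry set is $\mathrm{Ap}(M,x)=\{y\in M: y-x\notin M\}$. The repunit numbers in base $a$ are $\mathbf R_0=0$ and $\mathbf R_k=1+a+\cdots+a^{k-1}$ for $k\ge1$. For $r\ge 1$, a residual $r$-tuple (with respect to $a$) is a tuple of integers $(\alpha_1,\ldots,\alpha_r)$ such that (1) $0\le\alpha_i\le a$ for all $i$, and (2) if $\alpha_{i_0}=a$ for some $i_0\in\{2,\ldots,r\}$ then $\alpha_i=0$ for all $i\in\{1,\ldots,i_0-1\}$. *)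

(* Defs.v *)
From mathcomp Require Import all_boot all_order.
From mathcomp Require Import boolp classical_sets functions cardinality.

Set Implicit Arguments.
Unset Strict Implicit.
Unset Printing Implicit Defensive.

Local Open Scope classical_set_scope.
Local Open Scope card_scope.
Local Open Scope nat_scope.

Definition submonoid (M : set nat) : Prop :=
  M 0 /\ forall x y, M x -> M y -> M (x + y).

Definition generated (A : set nat) : set nat := smallest submonoid A.

Definition minimal_generators (M A : set nat) : Prop :=
  generated A = M /\ forall B : set nat, generated B = M -> A `<=` B.

(* e(M) = m *)
Definition embedding_dimension (M : set nat) (m : nat) : Prop :=
  exists2 A : set nat, minimal_generators M A & A #= `I_m.

(* "greatest" is with respect to divisibility, so that the gcd of [set 0] is 0 *)
Definition is_gcd (M : set nat) (g : nat) : Prop :=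
  (forall x, M x -> g %| x) /\
  forall h, (forall x, M x -> h %| x) -> h %| g.

(* (1 / lambda) M; the division is exact when lambda = gcd(M) *)
Definition divide_set (M : set nat) (lambda : nat) : set nat :=
  [set x %/ lambda | x in M].

Definition numerical_semigroup (S : set nat) : Prop :=
  submonoid S /\ finite_set (~` S).

Definition is_max (A : set nat) (x : nat) : Prop :=
  A x /\ forall y, A y -> y <= x.

Definition frobenius_number (S : set nat) (f : nat) : Prop := is_max (~` S) f.

(* y - x is an integer difference: when y < x it is negative, hence not in M *)
Definition Apery (M : set nat) (x : nat) : set nat :=
  [set y | M y /\ ~ (x <= y /\ M (y - x))].

(* R_k = 1 + a + ... + a^(k-1), with R_0 = 0 *)
Definition repunit (a k : nat) : nat := \sum_(i < k) a ^ i.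

(* s_j; for d < c * a and n >= 1 the subtraction does not truncate *)
Definition s_ (a c d n j : nat) : nat := c * a ^ (n + j) - d.

Definition S_ (a c d n : nat) : set nat := generated (range (s_ a c d n)).

(* Indices are shifted: tnth alpha i is alpha_(i+1), for 0 <= i < r. *)
Definition residual (a r : nat) (alpha : r.-tuple nat) : Prop :=
  (forall i, tnth alpha i <= a) /\
  (forall i0 : 'I_r, 0 < i0 -> tnth alpha i0 = a ->
     forall i : 'I_r, i < i0 -> tnth alpha i = 0).

(* alpha is a residual r-tuple with x = 1 + sum_(1 <= j <= r) alpha_j R_j *)
Definition residual_expansion (a r x : nat) (alpha : r.-tuple nat) : Prop :=
  residual a alpha /\ x = 1 + \sum_(j < r) tnth alpha j * repunit a j.+1.

(* Main.v *)
Require Import Defs.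
From mathcomp Require Import all_boot all_order.
From mathcomp Require Import boolp classical_sets functions cardinality.
From mathcomp Require Import zify.

(* Write p = s_0 and s_j = p + N R_j, where N = (a - 1) c a^n >= (a - 1) p. A sum
   of k generators whose repunits add up to w equals k p + N w, and its class
   modulo p depends only on w modulo t = p / lambda. Since R_(j+1) = 1 + a R_j,
   lowering w by one costs at most a - 1 extra generators, which is paid for by
   N; hence the least element f(w) with a given w is nondecreasing in w. The
   Apery set is therefore {f(0), ..., f(t - 1)} with maximum f(t - 1), and f(w)
   is attained by the greedy expansion of w in repunits, which is the residual
   one. Finally s_j is a minimal generator whenever R_j < t, so m = e(S_n)
   satisfies t <= R_m, which makes room for the expansion of t - 1. *)

Set Implicit Arguments.
Unset Strict Implicit.

(** * Repunits and lists of generator indices *)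

Lemma repunitS a k : repunit a k.+1 = 1 + a * repunit a k.
Proof.
rewrite /repunit big_ord_recl big_distrr; congr (_ + _); apply: eq_bigr => i _.
by rewrite /= -expnS.
Qed.

Lemma repunit0 a : repunit a 0 = 0.
Proof. exact: big_ord0. Qed.

Lemma ltn_repunit a : 0 < a -> {homo repunit a : j k / j < k}.
Proof.
move=> a_gt0; apply: homo_ltn => [x y z|j]; first exact: ltn_trans.
by rewrite repunitS; nia.
Qed.

(** A sum of generators is encoded by the list of their indices. Index 0 is allowed: it adds to the
    size but not to the weight, as R_0 = 0. *)
Definition weight (a : nat) (js : seq nat) : nat := \sum_(j <- js) repunit a j.

Lemma weight_cat a js ks : weight a (js ++ ks) = weight a js + weight a ks.
Proof. exact: big_cat. Qed.

Lemma weight_nseq a q j : weight a (nseq q j) = q * repunit a j.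
Proof. by rewrite /weight big_nseq iter_addn_0 mulnC. Qed.

Lemma weight_rem a j js : j \in js ->
  weight a js = repunit a j + weight a (rem j js).
Proof. by move=> js_j; rewrite /weight (big_rem j). Qed.

Lemma size_remS (T : eqType) (x : T) s : x \in s -> size s = (size (rem x s)).+1.
Proof. by move=> s_x; rewrite size_rem // prednK //; case: s s_x. Qed.

Lemma repunit_le_weight a j js : j \in js -> repunit a j <= weight a js.
Proof. by move=> /(weight_rem a) ->; apply: leq_addr. Qed.

Lemma weight0 a js : {in js, forall j, j = 0} -> weight a js = 0.
Proof.
by move=> js0; rewrite /weight big_seq big1 // => j /js0 ->; rewrite repunit0.
Qed.

(* One copy of R_(j+1) = 1 + a R_j is replaced by a copies of R_j. *)
Lemma weight_pred a (P : pred nat) js : (forall j, P j.+1 -> P j) ->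
  all P js -> 0 < weight a js ->
  exists ks, [/\ all P ks, weight a ks = (weight a js).-1
              & (size ks).+1 = size js + a].
Proof.
move=> Ppred Pjs w_gt0.
have [[|j] js_j jn0] : exists2 j, j \in js & j != 0; last 2 first.
- by [].
- exists (nseq a j ++ rem j.+1 js).
  rewrite weight_cat weight_nseq size_cat size_nseq (weight_rem a js_j).
  rewrite (size_remS js_j) repunitS all_cat all_nseq.
  rewrite (Ppred j) ?orbT; last by move/allP: Pjs; apply.
  split; [|lia|by rewrite addSn addnC].
  by apply/allP => k /mem_rem; move/allP: Pjs; apply.
apply/hasP; apply: contraLR w_gt0; rewrite -all_predC => /allP js0.
by rewrite weight0 // => j /js0 /= /negPn/eqP.
Qed.

Lemma weight_lower a (P : pred nat) js w : 0 < a -> (forall j, P j.+1 -> P j) ->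
  all P js -> w <= weight a js ->
  exists ks, [/\ all P ks, weight a ks = w
              & size ks <= size js + a.-1 * (weight a js - w)].
Proof.
move=> a_gt0 Ppred; move eq_e: (weight a js - w) => e.
elim: e js eq_e => [|e IHe] js eq_e Pjs w_le.
  by exists js; split=> //; lia.
have [|ks [Pks wks sks]] := @weight_pred a P js Ppred Pjs; first lia.
have [| | |ls [Pls wls sls]] := IHe ks => //; try lia.
by exists ls; split=> //; rewrite mulnS; lia.
Qed.

(* If R_(r+1) does not occur, then a copies of R_r can be removed instead, and
   lowering the remaining weight by one gives back at most a - 1 of them. *)
Lemma weight_greedy a r q js : 0 < a -> 0 < r ->
  all (fun j => j <= r) js -> q * repunit a r <= weight a js ->
  exists ks, [/\ all (fun j => j <= r) ks,
                 weight a ks + q * repunit a r = weight a js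
              & size ks + q <= size js].
Proof.
move=> a_gt0; elim: r q js => // r IHr q js _.
have strip1 ks : all (fun j => j <= r.+1) ks -> repunit a r.+1 <= weight a ks ->
    exists ls, [/\ all (fun j => j <= r.+1) ls,
                   weight a ls + repunit a r.+1 = weight a ks & size ls < size ks].
  move=> ks_le w_ge; have [ks_r|ks_r] := boolP (r.+1 \in ks).
    exists (rem r.+1 ks); rewrite (weight_rem a ks_r) addnC (size_remS ks_r).
    by split=> //; apply/allP => k /mem_rem /(allP ks_le).
  have {}ks_le : all (fun j => j <= r) ks.
    apply/allP => k ks_k; rewrite -ltnS ltn_neqAle (allP ks_le _ ks_k) andbT.
    by apply: contraNneq ks_r => <-.
  rewrite repunitS in w_ge *.
  (* The induction hypothesis requires [0 < r]. If r = 0, only zero indices remain, and their weight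
     0 is below R_1 = 1. *)
  case: (posnP r) => [r0|r_gt0].
    rewrite weight0 // in w_ge => k /(allP ks_le).
    by rewrite r0 leqn0 => /eqP.
  have [|ls [ls_le wls sls]] := IHr a ks r_gt0 ks_le; first lia.
  have [|||ms [ms_le wms sms]] := @weight_pred a (fun j => j <= r) ls.
  + by move=> j /ltnW.
  + exact: ls_le.
  + lia.
  exists ms; split; [|lia|lia].
  by apply: sub_all ms_le => j /leqW.
elim: q js => [|q IHq] js js_le w_ge; first by exists js; split=> //; lia.
have [|ks [ks_le wks sks]] := IHq js js_le; first lia.
have [|ls [ls_le wls sls]] := strip1 ks ks_le; first lia.
by exists ls; split=> //; lia.
Qed.

(** * Residual expansions in repunits *)

(* b i is the digit of R_(i+1). *)
Definition digit_sum (a : nat) (b : nat -> nat) (r : nat) : nat :=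
  \sum_(j < r) b j * repunit a j.+1.

(** Digits are a function on all of [nat], so that induction on [r] keeps the same [b] and only
    shortens the range. *)
Definition residual_digits (a r : nat) (b : nat -> nat) : Prop :=
  (forall i, i < r -> b i <= a) /\
  (forall i0 i, i0 < r -> b i0 = a -> i < i0 -> b i = 0).

Lemma digit_sumS a b r :
  digit_sum a b r.+1 = digit_sum a b r + b r * repunit a r.+1.
Proof. exact: big_ord_recr. Qed.

Lemma residual_digitsS a r b :
  residual_digits a r.+1 b -> residual_digits a r b.
Proof.
by move=> [b_le b_0]; split=> [i lt_ir|i0 i lt_ir]; [apply: b_le|apply: b_0]; lia.
Qed.

(** A top digit a forces all lower digits to vanish. A top digit at most a - 1 leaves room for the
    lower sum, which by induction is smaller than the top repunit. *)
Lemma residual_digit_sum_le a r b : 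
  residual_digits a r b -> digit_sum a b r <= a * repunit a r.
Proof.
elim: r => [|r IHr] res_b; first by rewrite /digit_sum big_ord0.
have := IHr (residual_digitsS res_b); case: res_b => b_le b_0.
rewrite digit_sumS repunitS.
have [br|br] := eqVneq (b r) a.
  rewrite /digit_sum big1 ?br // => i _.
  by rewrite (b_0 r) ?mul0n //.
have := b_le r (ltnSn r); nia.
Qed.

(** The lower digits sum to less than R_(r+1), so the top digit is the quotient by R_(r+1). *)
Lemma residual_digits_uniq a r b b' : 
  residual_digits a r b -> residual_digits a r b' ->
  digit_sum a b r = digit_sum a b' r -> forall i, i < r -> b i = b' i.
Proof.
elim: r => // r IHr res_b res_b'.
have res_br := residual_digitsS res_b.
have res_br' := residual_digitsS res_b'.
have := residual_digit_sum_le res_br; have := residual_digit_sum_le res_br'.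
rewrite !digit_sumS repunitS => le_b' le_b eq_bb'.
have eq_r : b r = b' r by nia.
move=> i; rewrite ltnS leq_eqVlt => /predU1P[->//|lt_ir].
by apply: IHr => //; move: eq_bb'; rewrite eq_r => /addIn.
Qed.

Lemma residual_digits_exist a r x : x <= a * repunit a r ->
  exists2 b, residual_digits a r b & x = digit_sum a b r.
Proof.
elim: r x => [|r IHr] x x_le.
  exists (fun=> 0); first by split.
  by rewrite /digit_sum big_ord0; move: x_le; rewrite repunit0 muln0; lia.
set R := repunit a r.+1.
have defR : R = 1 + a * repunit a r by rewrite /R repunitS.
have R_gt0 : 0 < R by rewrite defR.
have := ltn_pmod x R_gt0; rewrite {2}defR ltnS => /IHr[b [b_le b_0] xb].
have eqx := divn_eq x R.
have q_le : x %/ R <= a by rewrite -(mulnK a R_gt0) leq_div2r.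
(* A quotient a exhausts the bound on x, so the remainder is 0 and all lower digits are set to 0. *)
have [q_a|q_na] := eqVneq (x %/ R) a.
  exists (fun i => if i == r then a else 0).
    split=> [i _|i0 i lt_i0]; first by case: ifP.
    case: eqP => [->|_] a_eq lt_i; first by rewrite ltn_eqF.
    by rewrite -a_eq if_same.
  rewrite digit_sumS eqxx /digit_sum big1 => [|i _]; last first.
    by rewrite ltn_eqF.
  by rewrite eqx q_a; lia.
exists (fun i => if i == r then x %/ R else b i).
  split=> [i|i0 i].
    by rewrite ltnS leq_eqVlt; case: eqP => //= _ /b_le.
  rewrite ltnS leq_eqVlt; case: eqP => [->|_] /=.
    by move=> _ /eqP; rewrite (negPf q_na).
  move=> lt_i0 b_i0 lt_i; rewrite ltn_eqF ?(ltn_trans lt_i) //.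
  exact: b_0 b_i0 _.
rewrite digit_sumS eqxx {1}eqx xb addnC; congr (_ + _).
by apply: eq_bigr => i _; rewrite ltn_eqF.
Qed.

Lemma digit_listP a b r :
  exists js, weight a js = digit_sum a b r /\ size js = \sum_(i < r) b i.
Proof.
elim: r => [|r [js [wjs sjs]]].
  by exists [::]; rewrite /weight /digit_sum big_nil !big_ord0.
exists (nseq (b r) r.+1 ++ js).
rewrite weight_cat weight_nseq size_cat size_nseq digit_sumS big_ord_recr /=.
by rewrite wjs sjs; split; rewrite addnC.
Qed.

Lemma leq_index_weight a r js : 0 < a -> weight a js < repunit a r.+1 ->
  all (fun j => j <= r) js.
Proof.
move=> a_gt0 w_lt; apply/allP => j js_j; rewrite leqNgt; apply/negP => lt_rj.
have R_le := ltnW_homo (ltn_repunit a_gt0) lt_rj.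
by have := leq_trans R_le (repunit_le_weight a js_j); rewrite leqNgt w_lt.
Qed.

(** The weight is too small for an index above r. Then [weight_greedy] removes the copies of R_r
    prescribed by the top digit, shortening the list by at least that digit, and induction treats
    the rest. *)
Lemma residual_size_min a r b js : 0 < a -> residual_digits a r b ->
  weight a js = digit_sum a b r -> \sum_(i < r) b i <= size js.
Proof.
move=> a_gt0; elim: r js => [|r IHr] js res_b w_js; first by rewrite big_ord0.
have js_le : all (fun j => j <= r.+1) js.
  apply: (leq_index_weight a_gt0).
  by rewrite w_js repunitS ltnS residual_digit_sum_le.
have [|ks [_ wks sks]] := @weight_greedy a r.+1 (b r) js a_gt0 isT js_le.
  by rewrite w_js digit_sumS leq_addl.
rewrite big_ord_recr (leq_trans _ sks) // leq_add2r IHr //.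
  exact: residual_digitsS.
by move: wks; rewrite w_js digit_sumS => /addIn.
Qed.

(** * Values of index lists and the monoid they form *)

(* The sum of the generators s_j = p + N R_j over j in js. *)
Definition value (a p N : nat) (js : seq nat) : nat :=
  size js * p + N * weight a js.

Lemma value_cat a p N js ks :
  value a p N (js ++ ks) = value a p N js + value a p N ks.
Proof. by rewrite /value size_cat weight_cat; lia. Qed.

Lemma value_cons a p N j js :
  value a p N (j :: js) = p + N * repunit a j + value a p N js.
Proof. by rewrite /value /weight big_cons /=; lia. Qed.

Lemma value_nil a p N : value a p N [::] = 0.
Proof. by rewrite /value /weight big_nil muln0. Qed.

Lemma value1 a p N j : value a p N [:: j] = p + N * repunit a j.
Proof. by rewrite value_cons value_nil addn0. Qed.

Lemma value_zeros a p N t js : value a p N (nseq t 0 ++ js) = t * p + value a p N js.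
Proof.
by rewrite value_cat {1}/value size_nseq weight_nseq repunit0 !muln0 addn0.
Qed.

Lemma submonoid_generated A : submonoid (generated A).
Proof.
split=> [M [[]]//|x y Ax Ay M CM].
by case: (CM) => -[_ MD] _; apply: MD; [apply: Ax|apply: Ay].
Qed.

Lemma generated_value a p N :
  generated (range (fun j => p + N * repunit a j)) = range (value a p N).
Proof.
apply/seteqP; split.
  apply: smallest_sub; last first.
    move=> _ [j _ <-]; exists [:: j] => //.
    exact: value1.
  split; first by exists [::] => //; apply: value_nil.
  move=> _ _ [js _ <-] [ks _ <-]; exists (js ++ ks) => //.
  exact: value_cat.
move=> _ [js _ <-] M [[M0 MD] gensM].
elim: js => [|j js IHjs]; first by rewrite value_nil.
by rewrite value_cons; apply: MD => //; apply: gensM; exists j.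
Qed.

Lemma value_lower a p N js w : 0 < a -> a.-1 * p <= N -> w <= weight a js ->
  exists ks, weight a ks = w /\ value a p N ks <= value a p N js.
Proof.
move=> a_gt0 N_ge w_le.
have [//||ks [_ wks sks]] := @weight_lower a predT js w a_gt0 _ _ w_le.
  exact: all_predT.
exists ks; split=> //; rewrite /value wks.
have [e def_w] : exists e, weight a js = w + e by exists (weight a js - w); lia.
move: sks; rewrite def_w addKn mulnDr => sks.
have := leq_mul sks (leqnn p); have := leq_mul N_ge (leqnn e).
by rewrite mulnDl (mulnAC a.-1); lia.
Qed.

(** * Classes of values modulo s_0 *)

Lemma eqn_mod_coprime_mul2l v m x y : coprime m v ->
  (v * x == v * y %[mod m]) = (x == y %[mod m]).
Proof.
move=> co_mv; wlog le_yx : x y / y <= x.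
  by move=> Hw; case/orP: (leq_total x y) => /Hw // E; rewrite eq_sym E eq_sym.
by rewrite !eqn_mod_dvd ?leq_mul2l ?le_yx ?orbT // -mulnBr Gauss_dvdr.
Qed.

Lemma eqn_mod_addl_leq p x y : x == y %[mod p] -> x < y -> x + p <= y.
Proof.
move=> eq_xy lt_xy; move: eq_xy; rewrite eq_sym eqn_mod_dvd; last exact: ltnW.
by move/dvdn_leq; lia.
Qed.

Lemma value_scaled a l t v js :
  value a (l * t) (l * v) js = l * (size js * t + v * weight a js).
Proof. by rewrite /value mulnDr !mulnA (mulnC (size js)). Qed.

Lemma eqn_mod_value a l t v js y : 0 < l ->
  (value a (l * t) (l * v) js == l * y %[mod l * t]) =
  (v * weight a js == y %[mod t]).
Proof. by move=> l_gt0; rewrite value_scaled -!muln_modr eqn_pmul2l // modnMDl. Qed.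

Lemma eqn_mod_value2 a l t v js ks : 0 < l -> coprime t v ->
  (value a (l * t) (l * v) js == value a (l * t) (l * v) ks %[mod l * t]) =
  (weight a js == weight a ks %[mod t]).
Proof.
move=> l_gt0 co_tv; rewrite (value_scaled a l t v ks) eqn_mod_value //.
by rewrite modnMDl eqn_mod_coprime_mul2l.
Qed.

(** The difference is a multiple of p, supplied by copies of index 0, whose generator is p
    itself. *)
Lemma value_translate a p N js y : value a p N js <= y ->
  value a p N js == y %[mod p] -> range (value a p N) y.
Proof.
move=> le_y; rewrite eq_sym eqn_mod_dvd // => /dvdnP[k def_k].
by exists (nseq k 0 ++ js) => //; rewrite value_zeros -def_k subnK.
Qed.

(** * The maximum of the Apéry set and the gaps *)

Section ResidualMaximum.

(** Here [l], [t], [v] stand for lambda, s_0 / lambda and N / lambda; [co_tv] expresses that lambda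
    is the gcd. *)
Variables (a l t v r : nat) (b : nat -> nat).
Hypotheses (a_gt1 : 1 < a) (l_gt0 : 0 < l) (t_gt1 : 1 < t).
Hypotheses (co_tv : coprime t v) (v_ge : a.-1 * (l * t) <= l * v).
Hypotheses (res_b : residual_digits a r b) (t_eq : t = 1 + digit_sum a b r).

Let p := l * t.
Let N := l * v.
(** This is f(t - 1): the value of the list with digits [b], whose weight is t - 1 by [t_eq]. *)
Let X := (\sum_(i < r) b i) * p + N * digit_sum a b r.

Let a_gt0 : 0 < a. Proof. exact: ltnW. Qed.

Let p_gt0 : 0 < p. Proof. by rewrite muln_gt0 l_gt0 ltnW. Qed.

Lemma residual_max_value : range (value a p N) X.
Proof.
have [js [wjs sjs]] := digit_listP a b r.
by exists js; rewrite // /value wjs sjs.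
Qed.

(** Lowering the residual list from weight t - 1 to w does not raise its value. So every class
    modulo p that the monoid meets has an element at most X. *)
Lemma value_class w : w < t ->
  exists ks, weight a ks = w /\ value a p N ks <= X.
Proof.
move=> w_lt; have [js [wjs sjs]] := digit_listP a b r.
have [|ks [wks le_ks]] := @value_lower a p N js w a_gt0 v_ge.
  by rewrite wjs; lia.
by exists ks; split=> //; rewrite (leq_trans le_ks) // /value wjs sjs.
Qed.

Lemma residual_max_gt : p <= X.
Proof.
have d_gt0 : 0 < digit_sum a b r by lia.
have a1_gt0 : 0 < a.-1 by lia.
rewrite (leq_trans (leq_pmull p a1_gt0)) // (leq_trans v_ge) //.
by rewrite (leq_trans (leq_pmulr _ d_gt0)) // leq_addl.
Qed.

(** A list of value X - p would have weight congruent to t - 1 modulo t, hence at least t - 1.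
    Lowered to exactly t - 1 it has at least as many indices as the residual list, so its value is
    at least X. *)
Lemma residual_max_sub : ~ range (value a p N) (X - p).
Proof.
case=> js _ def_js; have [ls [wls sls]] := digit_listP a b r.
have val_ls : value a p N ls = X by rewrite /value wls sls.
have eq_w : weight a js == weight a ls %[mod t].
  rewrite -(eqn_mod_value2 a js ls l_gt0 co_tv) -/p -/N val_ls def_js.
  by rewrite -[in X in _ == X](subnK residual_max_gt) modnDr.
have w_ge : digit_sum a b r <= weight a js.
  have := leq_mod (weight a js) t; rewrite (eqP eq_w) wls modn_small //.
  by lia.
have [ks [wks le_ks]] := value_lower a_gt0 v_ge w_ge.
have := leq_mul (residual_size_min a_gt0 res_b wks) (leqnn p).
move: le_ks; rewrite -/p -/N def_js {1}/value wks.
by have := residual_max_gt; rewrite -/N /X; lia.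
Qed.

(** An element y > X lies above some element at most X of its own class, hence by at least p, so y -
    p is still in the monoid. *)
Lemma residual_max_apery y : Apery (range (value a p N)) p y -> y <= X.
Proof.
case=> [[js _ <-]] not_sub; rewrite leqNgt; apply/negP => gt_X.
have t_gt0 : 0 < t by lia.
have [ks [wks le_ks]] := value_class (ltn_pmod (weight a js) t_gt0).
have eq_val : value a p N ks == value a p N js %[mod p].
  by rewrite eqn_mod_value2 // wks modn_mod.
have lt_val : value a p N ks < value a p N js by lia.
have le_val := eqn_mod_addl_leq eq_val lt_val.
apply: not_sub; split; first lia.
apply: (@value_translate a p N ks); first lia.
have le_p : p <= value a p N js by lia.
by rewrite -(subnK le_p) modnDr in eq_val.
Qed.

Lemma residual_max_large y : X < l * y + p -> range (value a p N) (l * y).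
Proof.
move=> y_gt; have t_gt0 : 0 < t by lia.
have [w w_lt eq_w] : exists2 w, w < t & v * w == y %[mod t].
  (* The Chinese remainder that is y modulo t and 0 modulo v is a multiple k v, and k modulo t
     solves the congruence. *)
  have /eqP := chinese_modr co_tv y 0; rewrite mod0n => /dvdnP[k def_k].
  exists (k %% t); first exact: ltn_pmod.
  by rewrite modnMmr mulnC -def_k chinese_modl.
have [ks [wks le_ks]] := value_class w_lt.
have eq_val : value a p N ks == l * y %[mod p] by rewrite eqn_mod_value // wks.
apply: (value_translate _ eq_val); rewrite leqNgt; apply/negP => lt_y.
by move: (eq_val); rewrite eq_sym => /eqn_mod_addl_leq/(_ lt_y); lia.
Qed.

End ResidualMaximum.

(** * Irreducible elements and the embedding dimension *)

Lemma generating_irreducible (A : set nat) x : generated A x -> x <> 0 ->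
  (forall y z, generated A y -> generated A z -> y + z = x -> y = 0 \/ z = 0) ->
  A x.
Proof.
move=> Ax x_n0 irr_x; apply: contrapT => not_Ax.
have sub_gen : (A `<=` generated A)%classic by apply: sub_gen_smallest.
(* As x is irreducible and nonzero, removing it leaves a submonoid, which would still contain A. *)
suff [_] : [set y | generated A y /\ y <> x]%classic x by [].
apply: Ax; split.
- have [A0 AD] := submonoid_generated A; split; first by split; last exact/nesym.
  move=> y z [Ay y_x] [Az z_x]; split=> [|yz_x]; first exact: AD.
  case: (irr_x y z Ay Az yz_x) => E; move: yz_x; rewrite E.
    by rewrite add0n.
  by rewrite addn0.
- by move=> y Ay; split; [apply: sub_gen|move=> yx; apply: not_Ax; rewrite -yx].
Qed.

(** The weight is congruent to R_j < t, hence at least R_j, which leaves at most one p for the size.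
    This yields the irreducibility of s_j. *)
Lemma value_repunit_size a l t v j js : 0 < l -> 0 < t -> coprime t v ->
  repunit a j < t ->
  value a (l * t) (l * v) js = l * t + l * v * repunit a j -> size js <= 1.
Proof.
move=> l_gt0 t_gt0 co_tv lt_jt val_js.
have : weight a js == weight a [:: j] %[mod t].
  by rewrite -(eqn_mod_value2 a _ _ l_gt0 co_tv) val_js value1.
rewrite {2}/weight big_seq1 (modn_small lt_jt) => /eqP eq_w.
have := leq_mod (weight a js) t; rewrite eq_w => w_ge.
have := leq_mul (leqnn (l * v)) w_ge; move: val_js; rewrite /value => val_js le_N.
by rewrite -(leq_pmul2r (_ : 0 < l * t)) ?muln_gt0 ?l_gt0 // mul1n; lia.
Qed.

(* Otherwise s_0, ..., s_m are m + 1 irreducible elements. *)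
Lemma leq_repunit_embedding_dimension a l t v m :
  0 < a -> 0 < l -> 0 < t -> 0 < v ->
  coprime t v -> embedding_dimension (range (value a (l * t) (l * v))) m ->
  t <= repunit a m.
Proof.
move=> a_gt0 l_gt0 t_gt0 v_gt0 co_tv [A [genA _] cardA].
rewrite leqNgt; apply/negP => lt_mt.
pose s j := l * t + l * v * repunit a j.
have N_gt0 : 0 < l * v by rewrite muln_gt0 l_gt0.
have s_inj : injective s.
  move=> i j /addnI/eqP; rewrite eqn_pmul2l // => /eqP R_ij.
  by case: (ltngtP i j) => // /(ltn_repunit a_gt0); rewrite R_ij ltnn.
have sA : (s @` `I_m.+1 `<=` A)%classic.
  move=> _ [j /= lt_jm <-].
  have lt_jt : repunit a j < t.
    by apply: leq_ltn_trans lt_mt; apply: (ltnW_homo (ltn_repunit a_gt0)).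
  apply: generating_irreducible.
  - rewrite genA; exists [:: j] => //; apply: value1.
  - by rewrite /s; have := muln_gt0 l t; lia.
  - rewrite genA => _ _ [js _ <-] [ks _ <-].
    rewrite -value_cat => /(value_repunit_size l_gt0 t_gt0 co_tv lt_jt).
    rewrite size_cat; case: js => [|j0 js].
      by left; apply: value_nil.
    case: ks => [|k0 ks]; last by rewrite /= addnS.
    by right; apply: value_nil.
have : (`I_m.+1 #<= `I_m)%card.
  rewrite -(card_le_eqr cardA) -(card_le_eql (inj_card_eq (in2W s_inj))).
  exact: subset_card_le.
by rewrite card_le_II ltnn.
Qed.

(** If p divides N, all values are multiples of p, so p alone generates. This excludes t = 1 when m
    is at least 2. *)
Lemma embedding_dimension_dvd a p k m :
  embedding_dimension (range (value a p (k * p))) m -> m <= 1.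
Proof.
case=> A [_ minA] cardA.
have gen_p : generated [set p] = range (value a p (k * p)).
  apply/seteqP; split.
    apply: smallest_sub.
      by rewrite -generated_value; apply: submonoid_generated.
    by move=> _ ->; exists [:: 0] => //; rewrite value1 repunit0 muln0 addn0.
  move=> _ [js _ <-] M [[M0 MD] /(_ p erefl) Mp].
  rewrite /value mulnAC -mulnDl.
  by elim: (_ + _) => // q Mq; rewrite mulSn; apply: MD.
have /subset_card_le : (A `<=` [set p])%classic by apply: minA.
by rewrite (card_le_eql cardA) (card_le_eqr card_set1) card_le_II.
Qed.

(** * Application to the generators s_j *)

Lemma s_repunit a c d n j : 0 < a -> d <= c * a ^ n ->
  s_ a c d n j = s_ a c d n 0 + a.-1 * (c * a ^ n) * repunit a j.
Proof.
move=> a_gt0 le_d; rewrite /s_ addn0 expnD.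
have -> : a ^ j = 1 + a.-1 * repunit a j.
  by rewrite -predn_exp add1n prednK // expn_gt0 a_gt0.
rewrite !mulnDr muln1.
have -> : c * (a ^ n * (a.-1 * repunit a j)) = a.-1 * (c * a ^ n) * repunit a j by lia.
by rewrite addnBAC.
Qed.

(* In the last clause the subtraction is on nat; it does not truncate, since the
   Frobenius number lies outside the semigroup and is therefore nonzero. *)
Theorem corollary5p1 (a c d n m lambda : nat) :
  2 <= a -> 0 < c -> d < c * a -> coprime d a -> coprime d c -> 1 <= n ->
  0 < d ->
  embedding_dimension (S_ a c d n) m -> 2 <= m ->
  is_gcd (S_ a c d n) lambda ->
  (exists! alpha : m.-1.-tuple nat,
     residual_expansion a (s_ a c d n 0 %/ lambda) alpha) /\
  (forall alpha : m.-1.-tuple nat,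
     residual_expansion a (s_ a c d n 0 %/ lambda) alpha ->
     is_max (Apery (S_ a c d n) (s_ a c d n 0))
       (\sum_(j < m.-1) tnth alpha j * s_ a c d n j.+1) /\
     numerical_semigroup (divide_set (S_ a c d n) lambda) /\
     frobenius_number (divide_set (S_ a c d n) lambda)
       (\sum_(j < m.-1) tnth alpha j * (s_ a c d n j.+1 %/ lambda)
        - s_ a c d n 0 %/ lambda)).
Proof.
move=> a_gt1 c_gt0 lt_d _ _ n_gt0 _ dim_S m_gt1 [dvd_S gcd_S].
have a_gt0 : 0 < a by exact: ltnW.
have lt_dn : d < c * a ^ n.
  by rewrite (leq_trans lt_d) // leq_pmul2l // -{1}(expn1 a) leq_exp2l.
pose p := s_ a c d n 0; pose N := a.-1 * (c * a ^ n).
have p_gt0 : 0 < p by rewrite /p /s_ addn0 subn_gt0.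
have sE j : s_ a c d n j = p + N * repunit a j by rewrite s_repunit // ltnW.
have SE : S_ a c d n = range (value a p N).
  rewrite -generated_value /S_ (_ : s_ a c d n = fun j => p + N * repunit a j) //.
  exact: funext.
have N_ge : a.-1 * p <= N by rewrite leq_mul2l /p /s_ addn0 leq_subr orbT.
rewrite -/p {}SE in dim_S dvd_S gcd_S *.
have S1 js : lambda %| value a p N js by apply: dvd_S; exists js.
have dvd_p : lambda %| p by have := S1 [:: 0]; rewrite value1 repunit0 muln0 addn0.
have dvd_N : lambda %| N.
  by have := S1 [:: 1]; rewrite value1 repunitS repunit0 muln0 muln1 dvdn_addr.
have l_gt0 : 0 < lambda := dvdn_gt0 p_gt0 dvd_p.
pose t := p %/ lambda; pose v := N %/ lambda.
have def_p : p = lambda * t by rewrite mulnC divnK.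
have def_N : N = lambda * v by rewrite mulnC divnK.
have t_gt0 : 0 < t by move: p_gt0; rewrite def_p muln_gt0 => /andP[].
have N_gt0 : 0 < N by apply: leq_trans N_ge; rewrite muln_gt0 p_gt0 andbT; lia.
have v_gt0 : 0 < v by move: N_gt0; rewrite def_N muln_gt0 => /andP[].
(* The product of lambda and gcd(t, v) divides every value, hence divides lambda. *)
have co_tv : coprime t v.
  rewrite /coprime -dvdn1 -(dvdn_pmul2l l_gt0) muln1; apply: gcd_S => _ [js _ <-].
  rewrite /value def_p def_N; apply: dvdn_add.
    by rewrite mulnCA dvdn_pmul2l // dvdn_mull ?dvdn_gcdl.
  by rewrite -mulnA dvdn_pmul2l // dvdn_mulr ?dvdn_gcdr.
have t_gt1 : 1 < t.
  rewrite ltn_neqAle t_gt0 andbT; apply/eqP => t1.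
  have p_l : p = lambda by rewrite def_p -t1 muln1.
  move: dim_S; rewrite def_N mulnC -p_l => /embedding_dimension_dvd.
  by rewrite leqNgt m_gt1.
have le_tR : t <= repunit a m.
  apply: (leq_repunit_embedding_dimension a_gt0 l_gt0 t_gt0 v_gt0 co_tv).
  by rewrite -def_p -def_N.
(* By R_m = 1 + a R_(m-1), this is exactly the range in which m - 1 residual digits suffice. *)
have t1_le : t.-1 <= a * repunit a m.-1.
  by move: le_tR; case: (m) m_gt1 => //= k _; rewrite repunitS; lia.
have expansionP (alpha : m.-1.-tuple nat) : residual_expansion a t alpha <->
    residual_digits a m.-1 (nth 0 alpha) /\ t = 1 + digit_sum a (nth 0 alpha) m.-1.
  have -> : digit_sum a (nth 0 alpha) m.-1 =
      \sum_(j < m.-1) tnth alpha j * repunit a j.+1.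
    by apply: eq_bigr => j _; rewrite (tnth_nth 0).
  split=> -[[al_le al_0] t_eq]; split=> //; split=> [i|].
  - by move=> lt_i; have := al_le (Ordinal lt_i); rewrite (tnth_nth 0).
  - move=> i0 i lt_i0 al_i0 lt_i.
    have := al_0 (Ordinal lt_i0) _ _ (Ordinal (ltn_trans lt_i lt_i0)).
    rewrite !(tnth_nth 0) /=; apply=> //; exact: leq_ltn_trans lt_i.
  - by rewrite (tnth_nth 0); apply: al_le.
  - move=> i0 _ al_i0 i lt_i; move: al_i0; rewrite !(tnth_nth 0) => al_i0.
    exact: (al_0 _ _ _ al_i0).
split.
  have [b res_b t1_eq] := residual_digits_exist t1_le.
  pose alpha := [tuple b (val i) | i < m.-1].
  have al_b i : i < m.-1 -> nth 0 alpha i = b i.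
    by move=> lt_i; rewrite -(tnth_nth 0 alpha (Ordinal lt_i)) tnth_mktuple.
  have al_res : residual_expansion a t alpha.
    apply/expansionP; split.
      case: res_b => b_le b_0; split=> [i lt_i|i0 i lt_i0].
        by rewrite al_b //; apply: b_le.
      rewrite al_b // => b_i0 lt_i; rewrite al_b ?(ltn_trans lt_i) //.
      exact: b_0 b_i0 _.
    have -> : digit_sum a (nth 0 alpha) m.-1 = digit_sum a b m.-1.
      by apply: eq_bigr => i _; rewrite al_b.
    by rewrite -t1_eq add1n prednK.
  exists alpha; split=> // beta /expansionP[res_be t_be].
  have /expansionP[res_al t_al] := al_res.
  apply/eq_from_tnth => i; rewrite !(tnth_nth 0).
  apply: (residual_digits_uniq res_al res_be) => //.
  by move: t_al; rewrite t_be => /addnI.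
move=> alpha /expansionP[res_al t_al].
rewrite def_p def_N in N_ge.
have max_in := @residual_max_value a lambda t v m.-1 (nth 0 alpha).
have max_ge := residual_max_gt a_gt1 l_gt0 t_gt1 co_tv N_ge t_al.
have max_sub := residual_max_sub a_gt1 l_gt0 t_gt1 co_tv N_ge res_al t_al.
have max_ap := residual_max_apery a_gt1 l_gt0 t_gt1 co_tv N_ge t_al.
have max_large := residual_max_large a_gt1 l_gt0 t_gt1 co_tv N_ge t_al.
rewrite -def_p -def_N in max_in max_ge max_sub max_ap max_large.
set X := _ + _ in max_in max_ge max_sub max_ap max_large.
have sum_s : \sum_(j < m.-1) tnth alpha j * s_ a c d n j.+1 = X.
  rewrite /X /digit_sum big_distrl big_distrr -big_split /=.
  by apply: eq_bigr => j _; rewrite sE (tnth_nth 0) mulnDr (mulnCA N).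
have sum_s_div :
    lambda * (\sum_(j < m.-1) tnth alpha j * (s_ a c d n j.+1 %/ lambda)) = X.
  rewrite -sum_s big_distrr; apply: eq_bigr => j _.
  by rewrite /= mulnCA (mulnC lambda) divnK // sE -value1.
have divP y : divide_set (range (value a p N)) lambda y <->
    range (value a p N) (lambda * y).
  split=> [[x Sx <-]|Sy]; first by rewrite mulnC divnK //; apply: dvd_S.
  by exists (lambda * y); rewrite ?mulKn.
have S_sub : submonoid (range (value a p N)).
  by rewrite -generated_value; apply: submonoid_generated.
(* This one bound on gaps gives both the finiteness of the complement and the maximality of the
   Frobenius number. *)
have gap_le y : ~ divide_set (range (value a p N)) lambda y -> lambda * y + p <= X.
  by move=> not_y; rewrite leqNgt; apply/negP => /max_large/divP.
split; last split.
- rewrite sum_s; split; last exact: max_ap.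
  by split=> // -[_].
- split.
    split; first by apply/divP; rewrite muln0; case: S_sub.
    move=> x y /divP Sx /divP Sy; apply/divP; rewrite mulnDr.
    by case: S_sub => _; apply.
  apply: (@sub_finite_set _ _ `I_X.+1); last exact: finite_II.
  move=> y /gap_le le_X; rewrite /= ltnS.
  by rewrite (leq_trans _ le_X) // (leq_trans (leq_pmull y l_gt0)) // leq_addr.
- split.
    (* Multiplied by lambda, the candidate becomes X - p, which [max_sub] excludes. *)
    by move/divP; rewrite mulnBr sum_s_div -/t -def_p.
  move=> y /gap_le le_X; rewrite -(leq_pmul2l l_gt0) mulnBr sum_s_div -def_p.
  by rewrite leq_subRL // addnC.
Qed.
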